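(* Bour's minimal surface of value $3$, $\mathfrak{B}_3:\mathbb{R}^2\to\mathbb{R}^3$, $$\mathfrak{B}_3(u,v)=\left(-\tfrac{u^4}{4}-\tfrac{v^4}{4}+\tfrac32u^2v^2+\tfrac{u^2}{2}-\tfrac{v^2}{2},\; -u^3v+uv^3-uv,\; \tfrac23u^3-2uv^2\right),$$ is an algebraic minimal surface of degree $\deg(\mathfrak{B}_3)=16$.
   Context: A parametrized surface $\mathbf{x}(u,v)=(x(u,v),y(u,v),z(u,v))$ in $\mathbb{R}^3$ is algebraic if it satisfies an implicit equation $f(x,y,z)=0$ for a nonzero polynomial $f$. Its implicit equation is obtained by eliminating $u,v$, i.e. it is the irreducible polynomial $f\in\mathbb{R}[x,y,z]$ (unique up to a nonzero constant factor) such that $f(x(u,v),y(u,v),z(u,v))=0$ for all $(u,v)$. The degree of the surface is the total degree $\deg f$ of this polynomial. A minimal surface is a surface whose mean curvature vanishes identically at its regular points; $\mathfrak{B}_3$ may have a branch point at $(u,v)=(0,0)$, where it is not regular. *)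

(* Defs.v *)
From HB Require Import structures.
From mathcomp Require Import all_boot all_order all_algebra.
From mathcomp Require Import all_classical all_reals all_analysis.
(* The notations of mpoly clash with those of mathcomp-analysis. *)
From mathcomp Require Import -(notations) mpoly.

Set Implicit Arguments.
Unset Strict Implicit.
Unset Printing Implicit Defensive.

Import Order.TTheory GRing.Theory Num.Theory.
Import numFieldNormedType.Exports.

Local Open Scope classical_set_scope.
Local Open Scope ring_scope.

Section Space.
Context {R : realType}.
Implicit Types a b : 'rV[R]_3.

Definition dotv a b : R := \sum_i a 0 i * b 0 i.

(* Indices are in 'I_3, hence added modulo 3. *)
Definition crossv a b : 'rV[R]_3 :=
  \row_(i < 3) (a 0 (i + 1) * b 0 (i + 2) - a 0 (i + 2) * b 0 (i + 1)).

(* The library norm on row vectors is the sup norm, not this one. *)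
Definition enorm a : R := Num.sqrt (dotv a a).

End Space.

Section ParametrizedSurface.
Context {R : realType}.
Implicit Types (X : R * R -> 'rV[R]_3) (p : R * R).

Definition partial_u X : R * R -> 'rV[R]_3 := 'D_((1, 0) : R * R) X.
Definition partial_v X : R * R -> 'rV[R]_3 := 'D_((0, 1) : R * R) X.

(* Required of minimal surfaces because 'D_ has a meaningless default value
   where the derivative does not exist. *)
Definition twice_continuously_differentiable X : Prop :=
  forall w1 w2 : R * R,
    [/\ forall p, derivable X p w1,
        forall p, derivable ('D_w1 X) p w2
      & continuous ('D_w2 ('D_w1 X))].

Definition normal X p : 'rV[R]_3 := crossv (partial_u X p) (partial_v X p).

Definition regular_point X p : Prop := normal X p != 0.

Definition unit_normal X p : 'rV[R]_3 := (enorm (normal X p))^-1 *: normal X p.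

(* E, F, G and L, M, N are the coefficients of the first and second
   fundamental forms; the value is meaningful at regular points only. *)
Definition mean_curvature X p : R :=
  let E := dotv (partial_u X p) (partial_u X p) in
  let F := dotv (partial_u X p) (partial_v X p) in
  let G := dotv (partial_v X p) (partial_v X p) in
  let L := dotv (partial_u (partial_u X) p) (unit_normal X p) in
  let M := dotv (partial_v (partial_u X) p) (unit_normal X p) in
  let N := dotv (partial_v (partial_v X) p) (unit_normal X p) in
  (E * N - 2 * F * M + G * L) / (2 * (E * G - F ^+ 2)).

Definition minimal_surface X : Prop :=
  twice_continuously_differentiable X /\
  forall p, regular_point X p -> mean_curvature X p = 0.

Definition vanishes_on (f : mpoly 3 R) X : Prop :=
  forall p, meval (X p 0) f = 0.

Definition algebraic_surface X : Prop :=
  exists f : mpoly 3 R, f != 0 /\ vanishes_on f X.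

Definition irreducible (A : comUnitRingType) (f : A) : Prop :=
  [/\ f != 0, f \isn't a GRing.unit
    & forall g h : A, f = g * h ->
        g \is a GRing.unit \/ h \is a GRing.unit].

(* The last clause is the uniqueness of f up to a nonzero constant factor. *)
Definition implicit_equation X (f : mpoly 3 R) : Prop :=
  [/\ irreducible f, vanishes_on f X
    & forall g : mpoly 3 R, irreducible g -> vanishes_on g X ->
        exists2 c : R, c != 0 & g = c *: f].

(* msize is one more than the total degree. *)
Definition surface_degree X (d : nat) : Prop :=
  exists f : mpoly 3 R, implicit_equation X f /\ msize f = d.+1.

End ParametrizedSurface.

Definition Bour3 {R : realType} (p : R * R) : 'rV[R]_3 :=
  let u := p.1 in let v := p.2 in
  \row_(i < 3)
    [:: - (u ^+ 4 / 4) - v ^+ 4 / 4 + 3 / 2 * u ^+ 2 * v ^+ 2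
          + u ^+ 2 / 2 - v ^+ 2 / 2;
        - (u ^+ 3 * v) + u * v ^+ 3 - u * v;
        2 / 3 * u ^+ 3 - 2 * u * v ^+ 2]`_i.

(* Main.v *)
(* Write w = u + iv and let a, b stand for w and its conjugate. Then
   4 (x + iy) = 2 b^2 - a^4, 4 (x - iy) = 2 a^2 - b^4 and 3 z = a^3 + b^3.

   Eliminating a and b by hand gives a polynomial f(x, y, z) of total degree 16
   whose only term of degree 16 is a multiple of z^16, so every polynomial can
   be reduced modulo f to z-degree at most 15.

   No nonzero polynomial g of z-degree at most 15 vanishes on the surface: its
   leading form G for the weights (4, 4, 3) would satisfy
   G(- (a^4 + b^4) / 8, i (a^4 - b^4) / 8, (a^3 + b^3) / 3) = 0 for all complex
   a and b. Multiplying a and b by fourth roots of unity fixes the first two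
   arguments and gives the third one 16 distinct values.

   Hence f generates the ideal of the surface, which is prime; this gives
   irreducibility and uniqueness. Minimality holds because the parametrization
   is isothermal with harmonic coordinates. *)
Require Import Defs.
From mathcomp Require Import all_boot all_order all_algebra.
From mathcomp Require Import all_classical all_reals all_analysis.
From mathcomp Require Import -(notations) mpoly.
From mathcomp Require Import complex.
From mathcomp Require Import ring zify.

Set Implicit Arguments.
Unset Strict Implicit.
Unset Printing Implicit Defensive.

Import Order.TTheory GRing.Theory Num.Theory.
Import numFieldNormedType.Exports.

Local Open Scope classical_set_scope.
Local Open Scope ring_scope.

(** * Polynomial maps of the plane *)

Section PolynomialMaps.
Context {R : realType}.
Implicit Types (f g : R * R -> R) (p w : R * R).

(** The difference quotient is constant away from 0, so no limit has to be estimated. The two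
    coordinate functions are the intended instances. *)
Lemma is_derive_affine f p w d :
  (forall h, f (h *: w + p) = h * d + f p) -> is_derive p w f d.
Proof.
move=> fE; have fd : h^-1 *: (f (h *: w + p) - f p) @[h --> 0^'] --> d.
  apply: cvg_near_cst; near=> h.
  rewrite fE addrK /GRing.scale /= mulKf//.
  by near: h; exact: nbhs_dnbhs_neq.
by apply: DeriveDef; [apply/cvg_ex; exists d | exact/cvg_lim].
Unshelve. all: by end_near. Qed.

Lemma is_derive_fst p w : is_derive p w (fst : R * R -> R) w.1.
Proof. exact: is_derive_affine. Qed.

Lemma is_derive_snd p w : is_derive p w (snd : R * R -> R) w.2.
Proof. exact: is_derive_affine. Qed.

(** An inductive class can be matched against explicit coordinate formulas. Induction on it gives
    continuity and stability under directional derivatives, which together yield the required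
    regularity. *)
Inductive polynomial_map : (R * R -> R) -> Prop :=
| polynomial_fst : polynomial_map fst
| polynomial_snd : polynomial_map snd
| polynomial_cst (c : R) : polynomial_map (fun=> c)
| polynomialD f g : polynomial_map f -> polynomial_map g ->
    polynomial_map (fun p => f p + g p)
| polynomialM f g : polynomial_map f -> polynomial_map g ->
    polynomial_map (fun p => f p * g p).

Lemma polynomial_map_continuous f : polynomial_map f -> continuous f.
Proof.
elim=> [||c|{}f g _ cf _ cg|{}f g _ cf _ cg] p.
- exact: cvg_fst.
- exact: cvg_snd.
- exact: cvg_cst.
- by apply: cvgD; [exact: cf|exact: cg].
- by apply: cvgM; [exact: cf|exact: cg].
Qed.

(** Both claims go through one induction, because the sum and product rules for ['D_w] require
    derivable operands. *)
Lemma polynomial_map_derive f w : polynomial_map f ->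
  (forall p, derivable f p w) /\ polynomial_map ('D_w f).
Proof.
elim=> [||c|{}f g pf [df pdf] pg [dg pdg]|{}f g pf [df pdf] pg [dg pdg]].
- split=> [p|]; first by have [] := is_derive_fst p w.
  have -> : 'D_w (fst : R * R -> R) = fun=> w.1.
    by apply/funext => p; have [] := is_derive_fst p w.
  exact: polynomial_cst.
- split=> [p|]; first by have [] := is_derive_snd p w.
  have -> : 'D_w (snd : R * R -> R) = fun=> w.2.
    by apply/funext => p; have [] := is_derive_snd p w.
  exact: polynomial_cst.
- split=> [p|]; first exact: derivable_cst.
  have -> : 'D_w (fun=> c : R) = fun=> 0 :> R.
    by apply/funext => p; exact: derive_cst.
  exact: polynomial_cst.
- split=> [p|]; first exact: derivableD.
  have -> : 'D_w (fun p => f p + g p) = fun p => 'D_w f p + 'D_w g p.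
    by apply/funext => p; rewrite -deriveD.
  exact: polynomialD pdf pdg.
- split=> [p|]; first exact: derivableM.
  have -> : 'D_w (fun p => f p * g p) =
      fun p => f p * 'D_w g p + g p * 'D_w f p.
    by apply/funext => p; rewrite [LHS](deriveM (df p) (dg p)).
  exact: polynomialD (polynomialM pf pdg) (polynomialM pg pdf).
Qed.

Definition polynomial_surface (X : R * R -> 'rV[R]_3) :=
  forall i, polynomial_map (fun p => X p 0 i).

Lemma polynomial_surface_continuous X : polynomial_surface X -> continuous X.
Proof.
move=> pX p A [P nP sPA]; apply: filterS (sPA) _ => /=.
(* A neighbourhood of a row vector contains a product of neighbourhoods of its entries. There are
   finitely many entries, so the conditions on them hold simultaneously near [p]. *)
have : \forall q \near p, forall i, P 0 i (X q 0 i).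
  apply: (@filter_forall _ _ (fun i q => P 0 i (X q 0 i)) _ (nbhs_filter p)) => i.
  exact: (polynomial_map_continuous (pX i) (nP 0 i)).
by apply: filterS => q Pq i j; rewrite (ord1 i); exact: Pq.
Qed.

Lemma polynomial_surface_derivable X p w :
  polynomial_surface X -> derivable X p w.
Proof.
by move=> pX; apply/derivable_mxP => i j; rewrite (ord1 i);
  exact: (polynomial_map_derive w (pX j)).1.
Qed.

Lemma derive_polynomial_surface X p w : polynomial_surface X ->
  'D_w X p = \row_i 'D_w (fun q => X q 0 i) p.
Proof.
move=> pX; rewrite derive_mx; last exact: polynomial_surface_derivable.
by apply/matrixP => i j; rewrite !mxE (ord1 i).
Qed.

Lemma polynomial_surface_derive X w :
  polynomial_surface X -> polynomial_surface ('D_w X).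
Proof.
move=> pX i; have -> : (fun p => 'D_w X p 0 i) = 'D_w (fun q => X q 0 i).
  by apply/funext => p; rewrite derive_polynomial_surface// mxE.
exact: (polynomial_map_derive w (pX i)).2.
Qed.

Lemma polynomial_surface_C2 X :
  polynomial_surface X -> twice_continuously_differentiable X.
Proof.
move=> pX w1 w2; split=> [p|p|].
- exact: polynomial_surface_derivable.
- exact/polynomial_surface_derivable/polynomial_surface_derive.
- exact/polynomial_surface_continuous/polynomial_surface_derive/polynomial_surface_derive.
Qed.

End PolynomialMaps.

(** * Minimality *)

Section Minimality.
Context {R : realType}.
Implicit Types (f g : R * R -> R) (p w : R * R).

Lemma ord3_ind (P : 'I_3 -> Prop) : P 0 -> P 1 -> P 2 -> forall i, P i.
Proof.
move=> P0 P1 P2 [[|[|[|//]]] i3].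
- by rewrite (_ : Ordinal i3 = 0)//; exact: val_inj.
- by rewrite (_ : Ordinal i3 = 1)//; exact: val_inj.
- by rewrite (_ : Ordinal i3 = 2)//; exact: val_inj.
Qed.

Definition row3 (a b c : R) : 'rV[R]_3 := \row_(i < 3) [:: a; b; c]`_i.

Lemma row3P (v : 'rV[R]_3) a b c :
  v 0 0 = a -> v 0 1 = b -> v 0 2 = c -> v = row3 a b c.
Proof.
by move=> <- <- <-; apply/rowP; apply: ord3_ind; rewrite mxE.
Qed.

Lemma dotv_row3 a b c a' b' c' :
  dotv (row3 a b c) (row3 a' b' c') = a * a' + b * b' + c * c'.
Proof. by rewrite /dotv !big_ord_recl big_ord0 !mxE /= addr0 addrA. Qed.

Lemma is_derive_row3 f g h p w df dg dh :
  is_derive p w f df -> is_derive p w g dg -> is_derive p w h dh ->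
  'D_w (fun q => row3 (f q) (g q) (h q)) p = row3 df dg dh.
Proof.
move=> [fd fE] [gd gE] [hd hE]; set X := fun q => row3 _ _ _.
have X0 : (fun q => X q 0 0) = f by apply/funext => q; rewrite mxE.
have X1 : (fun q => X q 0 1) = g by apply/funext => q; rewrite mxE.
have X2 : (fun q => X q 0 2) = h by apply/funext => q; rewrite mxE.
rewrite derive_mx; last first.
  apply/derivable_mxP => j; rewrite (ord1 j).
  clearbody X; elim/ord3_ind.
  - rewrite X0; exact: fd.
  - rewrite X1; exact: gd.
  - rewrite X2; exact: hd.
by apply: row3P; rewrite mxE; [rewrite X0 | rewrite X1 | rewrite X2].
Qed.

(** This rule and the next three are pointwise forms of the derivation rules, written with [fun q]
    so that they unify with explicit coordinate formulas. *)
Let is_deriveD_fun f g p w df dg : is_derive p w f df -> is_derive p w g dg ->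
  is_derive p w (fun q => f q + g q) (df + dg).
Proof. exact: is_deriveD. Qed.

Let is_deriveN_fun f p w df : is_derive p w f df ->
  is_derive p w (fun q => - f q) (- df).
Proof. exact: is_deriveN. Qed.

Let is_deriveM_fun f g p w df dg : is_derive p w f df -> is_derive p w g dg ->
  is_derive p w (fun q => f q * g q) (f p * dg + g p * df).
Proof. exact: is_deriveM. Qed.

Let is_deriveX_fun f n p w df : is_derive p w f df ->
  is_derive p w (fun q => f q ^+ n) (n%:R * f p ^+ n.-1 * df).
Proof.
by move=> fd; have := is_deriveX n fd; rewrite exprfctE.
Qed.

Ltac derive_polynomial :=
  apply: is_derive_eq;
  [repeat first
    [ exact: is_derive_fst | exact: is_derive_snd | exact: is_derive_cst
    | apply: is_deriveD_fun | apply: is_deriveN_fun | apply: is_deriveX_fun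
    | apply: is_deriveM_fun ]
  | rewrite /=; field ].

Lemma Bour3E : @Bour3 R = fun p => row3
  (- (p.1 ^+ 4 / 4) - p.2 ^+ 4 / 4 + 3 / 2 * p.1 ^+ 2 * p.2 ^+ 2
     + p.1 ^+ 2 / 2 - p.2 ^+ 2 / 2)
  (- (p.1 ^+ 3 * p.2) + p.1 * p.2 ^+ 3 - p.1 * p.2)
  (2 / 3 * p.1 ^+ 3 - 2 * p.1 * p.2 ^+ 2).
Proof. by []. Qed.

Lemma partial_u_Bour3 : partial_u (@Bour3 R) = fun p => row3
  (- p.1 ^+ 3 + 3 * p.1 * p.2 ^+ 2 + p.1)
  (- 3 * p.1 ^+ 2 * p.2 + p.2 ^+ 3 - p.2)
  (2 * p.1 ^+ 2 - 2 * p.2 ^+ 2).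
Proof.
apply/funext => p; rewrite /partial_u Bour3E.
by apply: is_derive_row3; derive_polynomial.
Qed.

Lemma partial_v_Bour3 : partial_v (@Bour3 R) = fun p => row3
  (- p.2 ^+ 3 + 3 * p.1 ^+ 2 * p.2 - p.2)
  (- p.1 ^+ 3 + 3 * p.1 * p.2 ^+ 2 - p.1)
  (- 4 * p.1 * p.2).
Proof.
apply/funext => p; rewrite /partial_v Bour3E.
by apply: is_derive_row3; derive_polynomial.
Qed.

Lemma partial_uu_Bour3 : partial_u (partial_u (@Bour3 R)) = fun p => row3
  (- 3 * p.1 ^+ 2 + 3 * p.2 ^+ 2 + 1) (- 6 * p.1 * p.2) (4 * p.1).
Proof.
apply/funext => p; rewrite partial_u_Bour3 /partial_u.
by apply: is_derive_row3; derive_polynomial.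
Qed.

Lemma partial_vv_Bour3 : partial_v (partial_v (@Bour3 R)) = fun p => row3
  (3 * p.1 ^+ 2 - 3 * p.2 ^+ 2 - 1) (6 * p.1 * p.2) (- 4 * p.1).
Proof.
apply/funext => p; rewrite partial_v_Bour3 /partial_v.
by apply: is_derive_row3; derive_polynomial.
Qed.

(** When E = G and F = 0 the numerator is E (L + N). Harmonicity gives N = - L, whatever vector
    stands for the normal. *)
Lemma mean_curvature_isothermal_harmonic (X : R * R -> 'rV[R]_3) p :
  dotv (partial_u X p) (partial_u X p) = dotv (partial_v X p) (partial_v X p) ->
  dotv (partial_u X p) (partial_v X p) = 0 ->
  partial_v (partial_v X) p = - partial_u (partial_u X) p ->
  mean_curvature X p = 0.
Proof.
rewrite /mean_curvature.
generalize (partial_v (partial_v X) p) (partial_u (partial_u X) p).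
generalize (partial_u X p) (partial_v X p) (unit_normal X p) => a b n c d EG F0 ->.
have -> : dotv (- d) n = - dotv d n.
  by rewrite /dotv -sumrN; apply: eq_bigr => i _; rewrite mxE mulNr.
by rewrite F0 EG mulr0 mul0r subr0 mulrN addNr mul0r.
Qed.

Lemma mean_curvature_Bour3 p : mean_curvature (@Bour3 R) p = 0.
Proof.
apply: mean_curvature_isothermal_harmonic.
- by rewrite partial_u_Bour3 partial_v_Bour3 !dotv_row3; ring.
- by rewrite partial_u_Bour3 partial_v_Bour3 dotv_row3; ring.
- rewrite partial_uu_Bour3 partial_vv_Bour3; apply/esym.
  by apply: row3P; rewrite !mxE /=; ring.
Qed.

Lemma polynomial_surface_Bour3 : polynomial_surface (@Bour3 R).
Proof.
have pN f : polynomial_map f -> polynomial_map (fun p => - f p).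
  move=> pf; rewrite (_ : (fun _ => _) = fun p => -1 * f p).
    exact: polynomialM (polynomial_cst _) pf.
  by apply/funext => p; rewrite mulN1r.
have pX f n : polynomial_map f -> polynomial_map (fun p => f p ^+ n).
  move=> pf; elim: n => [|n IH]; first exact: polynomial_cst.
  rewrite (_ : (fun _ => _) = fun p => f p * f p ^+ n).
    exact: polynomialM pf IH.
  by apply/funext => p; rewrite exprS.
rewrite Bour3E; apply: ord3_ind.
all: under eq_fun do rewrite mxE /=.
all: repeat first
    [ exact: polynomial_fst | exact: polynomial_snd | exact: polynomial_cst
    | apply: polynomialD | apply: pN | apply: pX | apply: polynomialM ].
Qed.

Lemma minimal_surface_Bour3 : minimal_surface (@Bour3 R).
Proof.
split; first exact: polynomial_surface_C2 polynomial_surface_Bour3.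
by move=> p _; exact: mean_curvature_Bour3.
Qed.

End Minimality.

(** * The leading form of an equation of the surface *)

Section PolynomialFunctions.
Context {K : numFieldType}.
Implicit Types (h : K -> K) (c : K).

(** This makes the identity principle available for functions given by formulas, without computing
    the polynomial. *)
Definition polyfun h := exists p : {poly K}, forall x, h x = p.[x].

Lemma polyfun_cst c : polyfun (fun=> c).
Proof. by exists c%:P => x; rewrite hornerC. Qed.

Lemma polyfun_id : polyfun id.
Proof. by exists 'X => x; rewrite hornerX. Qed.

Lemma polyfunD h1 h2 : polyfun h1 -> polyfun h2 -> polyfun (fun x => h1 x + h2 x).
Proof. by case=> p hp [q hq]; exists (p + q) => x; rewrite hornerD hp hq. Qed.

Lemma polyfunM h1 h2 : polyfun h1 -> polyfun h2 -> polyfun (fun x => h1 x * h2 x).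
Proof. by case=> p hp [q hq]; exists (p * q) => x; rewrite hornerM hp hq. Qed.

Lemma polyfunN h : polyfun h -> polyfun (fun x => - h x).
Proof. by case=> p hp; exists (- p) => x; rewrite hornerN hp. Qed.

Lemma polyfunX h n : polyfun h -> polyfun (fun x => h x ^+ n).
Proof. by case=> p hp; exists (p ^+ n) => x; rewrite horner_exp hp. Qed.

Lemma polyfun_sum (I : Type) (r : seq I) (P : pred I) (F : I -> K -> K) :
  (forall i, polyfun (F i)) -> polyfun (fun x => \sum_(i <- r | P i) F i x).
Proof.
move=> pF; have /choice[p hp] := pF.
by exists (\sum_(i <- r | P i) p i) => x; rewrite horner_sum; apply: eq_bigr.
Qed.

Lemma polyfun_prod (I : Type) (r : seq I) (P : pred I) (F : I -> K -> K) :
  (forall i, polyfun (F i)) -> polyfun (fun x => \prod_(i <- r | P i) F i x).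
Proof.
move=> pF; have /choice[p hp] := pF.
by exists (\prod_(i <- r | P i) p i) => x; rewrite horner_prod; apply: eq_bigr.
Qed.

(** In characteristic 0 the positive integers are distinct, so there are more roots than the degree
    allows. Leaving 0 out permits substitutions that divide by the argument, as in
    [leading_form_vanish]. *)
Lemma poly_eq0_nat (p : {poly K}) : (forall n, p.[n.+1%:R] = 0) -> p = 0.
Proof.
move=> p0; apply: (@roots_geq_poly_eq0 _ _ [seq n.+1%:R | n <- iota 0 (size p)]).
- by apply/allP => _ /mapP[n _ ->]; rewrite /root p0.
- by rewrite map_inj_uniq ?iota_uniq// => m n /eqP; rewrite eqr_nat => /eqP[].
- by rewrite size_map size_iota.
Qed.

Lemma polyfun_eq0 h : polyfun h -> (forall n, h n.+1%:R = 0) -> forall x, h x = 0.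
Proof.
case=> p hp h0 x; rewrite hp (_ : p = 0) ?horner0//.
by apply: poly_eq0_nat => n; rewrite -hp.
Qed.

End PolynomialFunctions.

Ltac solve_polyfun := repeat first
  [ exact: polyfun_cst | exact: polyfun_id | apply: polyfunD | apply: polyfunN
  | apply: polyfunX | apply: polyfunM ].

Section EvaluationBy.
Context {R : fieldType} {C : numFieldType} (iota : {rmorphism R -> C}).
Implicit Types (g : mpoly 3 R) (m : multinom 3) (h : 'I_3 -> C).

Lemma mmapE3 h g : mmap iota h g =
  \sum_(m <- msupp g) iota (mcoeff m g) * (h 0 ^+ m 0 * h 1 ^+ m 1 * h 2 ^+ m 2).
Proof.
apply: eq_bigr => m _; congr (_ * _); rewrite /mmap1 !big_ord_recl big_ord0 mulr1.
rewrite mulrA; congr (h _ ^+ m _ * h _ ^+ m _ * h _ ^+ m _); exact: val_inj.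
Qed.

Lemma polyfun_mmap (h : C -> 'I_3 -> C) g :
  (forall i, polyfun (fun x => h x i)) -> polyfun (fun x => mmap iota (h x) g).
Proof.
move=> ph; apply: polyfun_sum => m; apply: polyfunM; first exact: polyfun_cst.
by apply: polyfun_prod => i; exact: polyfunX.
Qed.

Lemma mmap_meval (v : 'I_3 -> R) g :
  mmap iota (fun i => iota (v i)) g = iota (meval v g).
Proof.
rewrite mevalE rmorph_sum; apply: eq_bigr => m _.
rewrite rmorphM rmorph_prod; congr (_ * _).
by apply: eq_bigr => i _; rewrite rmorphXn.
Qed.

End EvaluationBy.

(** The coordinates of [Bour3] over any field, in the form of a valuation for [meval] and [mmap].
    This gives access to complex parameters. *)
Definition bour_coord (K : fieldType) (u v : K) (i : 'I_3) : K :=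
  [:: - (u ^+ 4 / 4) - v ^+ 4 / 4 + 3 / 2 * u ^+ 2 * v ^+ 2
        + u ^+ 2 / 2 - v ^+ 2 / 2;
      - (u ^+ 3 * v) + u * v ^+ 3 - u * v;
      2 / 3 * u ^+ 3 - 2 * u * v ^+ 2]`_i.

Section Kernel.
Context {R : fieldType} {C : numClosedFieldType} (iota : {rmorphism R -> C}).
Implicit Types (g : mpoly 3 R) (m : multinom 3).

Lemma rmorph_bour_coord (u v : R) i :
  iota (bour_coord u v i) = bour_coord (iota u) (iota v) i.
Proof.
elim/ord3_ind: i; rewrite /bour_coord /=.
all: by rewrite ?(rmorphXn, rmorph_nat, fmorphV, rmorphN, rmorphD, rmorphM).
Qed.

(** Natural numbers are images of elements of [R], so the equation holds at natural parameters. The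
    identity principle then frees [u], and after it [v]. *)
Lemma bour_vanish_complex g :
  (forall u v, meval (bour_coord u v) g = 0) ->
  forall u v : C, mmap iota (bour_coord u v) g = 0.
Proof.
move=> g0 u v.
have nn (n k : nat) : mmap iota (bour_coord n%:R k%:R) g = 0.
  rewrite -(rmorph_nat iota n) -(rmorph_nat iota k).
  rewrite -[RHS](rmorph0 iota) -(g0 n%:R k%:R) -mmap_meval.
  by congr (mmap iota _ g); apply/funext => i; rewrite -rmorph_bour_coord.
have un (k : nat) x : mmap iota (bour_coord x k%:R) g = 0.
  apply: (polyfun_eq0 (h := fun x => mmap iota (bour_coord x k%:R) g)) => //.
  by apply: polyfun_mmap; apply: ord3_ind; rewrite /bour_coord /=; solve_polyfun.
apply: (polyfun_eq0 (h := fun x => mmap iota (bour_coord u x) g)) => //.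
by apply: polyfun_mmap; apply: ord3_ind; rewrite /bour_coord /=; solve_polyfun.
Qed.

Definition bour_weight m := (4 * m 0%R + 4 * m 1%R + 3 * m 2%R)%N.

(** Take the parameters with u + iv = a / t and u - iv = b / t. Then t^4 x, t^4 y and t^3 z are the
    polynomials [X0 t], [X1 t] and [X2] in t, and t^N g(x, y, z) is a polynomial [h] in t that
    vanishes at positive integers. Its value at t = 0 is the leading form. *)
Lemma leading_form_vanish g (N : nat) (a b : C) :
  (forall u v : C, mmap iota (bour_coord u v) g = 0) ->
  (forall m, m \in msupp g -> (bour_weight m <= N)%N) ->
  \sum_(m <- msupp g | bour_weight m == N) iota (mcoeff m g) *
    ((- (a ^+ 4 + b ^+ 4) / 8) ^+ m 0 * ('i * (a ^+ 4 - b ^+ 4) / 8) ^+ m 1 *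
     ((a ^+ 3 + b ^+ 3) / 3) ^+ m 2) = 0.
Proof.
move=> g0 leN.
pose X0 t := - (a ^+ 4 + b ^+ 4) / 8 + t ^+ 2 * ((a ^+ 2 + b ^+ 2) / 4).
pose X1 t := 'i * (a ^+ 4 - b ^+ 4) / 8 + t ^+ 2 * ('i * (a ^+ 2 - b ^+ 2) / 4).
pose X2 := (a ^+ 3 + b ^+ 3) / 3.
pose h t := \sum_(m <- msupp g) iota (mcoeff m g) *
  (X0 t ^+ m 0 * X1 t ^+ m 1 * X2 ^+ m 2) * t ^+ (N - bour_weight m).
have h0 : h 0 = 0.
  apply: polyfun_eq0 => [|n].
    apply: polyfun_sum => m; rewrite /X0 /X1 /X2; solve_polyfun.
  set t : C := n.+1%:R.
  have t0 : t != 0 by rewrite pnatr_eq0.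
  rewrite -(mulr0 (t ^+ N)).
  rewrite -(g0 ((a + b) / 2 / t) ('i * (b - a) / 2 / t)) mmapE3 big_distrr.
  have i2 := sqrCi C.
  have x0 : X0 t = t ^+ 4 * bour_coord ((a + b) / 2 / t) ('i * (b - a) / 2 / t) 0.
    by rewrite /X0 /bour_coord /=; field: i2.
  have x1 : X1 t = t ^+ 4 * bour_coord ((a + b) / 2 / t) ('i * (b - a) / 2 / t) 1.
    by rewrite /X1 /bour_coord /=; field: i2.
  have x2 : X2 = t ^+ 3 * bour_coord ((a + b) / 2 / t) ('i * (b - a) / 2 / t) 2.
    by rewrite /X2 /bour_coord /=; field: i2.
  rewrite /h x0 x1 x2; apply: eq_big_seq => m mg /=.
  have -> : t ^+ N = (t ^+ 4) ^+ m 0 * (t ^+ 4) ^+ m 1 * (t ^+ 3) ^+ m 2 *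
      t ^+ (N - bour_weight m).
    by rewrite -!exprM -!exprD (subnKC (leN m mg)).
  move: (t ^+ 4) (t ^+ 3) (t ^+ _) => y z w.
  rewrite !exprMn; move: (y ^+ m 0) (y ^+ m 1) (z ^+ m 2) => y0 y1 z2.
  by ring.
rewrite -{}[RHS]h0 /h big_mkcond; apply: eq_big_seq => m mg /=.
(* At t = 0 the last factor is 1 if the truncated difference [N - bour_weight m] is 0 and 0
   otherwise. Since weights are at most [N], exactly the terms of weight [N] survive. *)
rewrite /X0 /X1 expr0n /= !mul0r !addr0 expr0n subn_eq0.
case: eqP => [->|wN]; first by rewrite leqnn mulr1.
by rewrite leqNgt ltn_neqAle leN// andbT; case: eqP wN => //= _ _; rewrite mulr0.
Qed.

End Kernel.

(** * Combinations of fourth roots of unity *)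

Section FourthRoots.
Context {C : numClosedFieldType}.

Definition fourth_roots : seq C := [:: 1; 'i; -1; - 'i].

Lemma fourth_rootsP (s : C) : s \in fourth_roots -> s ^+ 4 = 1.
Proof.
have i2 := sqrCi C; rewrite !inE.
by move=> /or4P[] /eqP ->; [ring | ring: i2 | ring | ring: i2].
Qed.

Lemma fourth_roots_uniq : uniq fourth_roots.
Proof.
have i2 := sqrCi C.
have n1 : (1 : C) != -1 by rewrite -addr_eq0 -(natrD _ 1 1) pnatr_eq0.
have ni (x : C) : x ^+ 2 = 1 -> 'i != x.
  by move=> x2; apply/eqP => ix; move/eqP: i2; rewrite ix x2 (negPf n1).
have ii : 'i != - 'i :> C.
  by rewrite -addr_eq0 -mulr2n -mulr_natr mulf_neq0 ?neq0Ci ?pnatr_eq0.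
rewrite /= !inE !negb_or n1 ii eq_sym !ni ?expr1n ?sqrrN ?expr1n//=.
by rewrite -eqr_oppLR eq_sym ni ?sqrrN ?expr1n //= eqr_opp eq_sym ni ?expr1n.
Qed.

(** The differences are 0, then 2 times a fourth root of unity, then the four numbers ±1 ± i, whose
    squares are ±2i. *)
Lemma fourth_roots_sub4 (s t : C) : s \in fourth_roots -> t \in fourth_roots ->
  (s - t) ^+ 4 \in [:: 0; 16; -4].
Proof.
have i2 := sqrCi C; rewrite !inE.
move=> /or4P[] /eqP -> /or4P[] /eqP ->.
all: apply/or3P;
  first [ by constructor 1; apply/eqP; ring: i2
        | by constructor 2; apply/eqP; ring: i2
        | by constructor 3; apply/eqP; ring: i2 ].
Qed.

(** This number is the imaginary part of (n + i)^3, so that cube is not real. Reduction modulo 3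
    excludes 3 n^2 = 1. *)
Lemma three_natr_sqr_sub1_neq0 (n : nat) : (3 * n%:R ^+ 2 - 1 : C) != 0.
Proof.
rewrite subr_eq0 -natrX -natrM pnatr_eq1.
by apply/eqP => n1; have := congr1 (fun k => k %% 3)%N n1; rewrite modnMr.
Qed.

(* Complex conjugation exchanges [alpha ^+ 4] and [beta ^+ 4], so a coincidence
   makes [(s - s') ^+ 4] and [(t' - t) ^+ 4] opposite; their possible values
   [0], [16], [-4] then force both to vanish. *)
Lemma fourth_roots_comb_inj (n : nat) (alpha beta s t s' t' : C) :
  alpha ^+ 4 = (n%:R + 'i) ^+ 3 -> beta ^+ 4 = (n%:R - 'i) ^+ 3 ->
  s \in fourth_roots -> t \in fourth_roots ->
  s' \in fourth_roots -> t' \in fourth_roots ->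
  s * alpha + t * beta = s' * alpha + t' * beta -> s = s' /\ t = t'.
Proof.
move=> a4 b4 sP tP s'P t'P E.
have i2 := sqrCi C.
have {}E : (s - s') * alpha = (t' - t) * beta.
  rewrite (_ : _ * _ = (s * alpha + t * beta) - t * beta - s' * alpha); last by ring.
  by rewrite E; ring.
have {}E : (s - s') ^+ 4 * (n%:R + 'i) ^+ 3 = (t' - t) ^+ 4 * (n%:R - 'i) ^+ 3.
  by rewrite -a4 -b4 -!exprMn E.
have sr := fourth_roots_sub4 sP s'P; have tr := fourth_roots_sub4 t'P tP.
have realr (r : C) : r \in [:: 0; 16; -4] -> r^* = r.
  by rewrite !inE => /or3P[] /eqP ->; rewrite ?raddfN /= ?conjC0 ?conjC_nat.
suff r0 : (s - s') ^+ 4 = 0 /\ (t' - t) ^+ 4 = 0.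
  case: r0 => /eqP; rewrite expf_eq0 subr_eq0 /= => /eqP -> /eqP.
  by rewrite expf_eq0 subr_eq0 /= => /eqP ->.
move: ((s - s') ^+ 4) ((t' - t) ^+ 4) E sr tr => r r' E sr tr.
have Ec : r * (n%:R - 'i) ^+ 3 = r' * (n%:R + 'i) ^+ 3.
  move: (congr1 Num.conj E); rewrite (rmorphM _ r) (rmorphM _ r') !rmorphXn /=.
  rewrite rmorphB rmorphD /=.
  by rewrite conjCi conjC_nat opprK !realr.
have /eqP : (r + r') * (2 * 'i * (3 * n%:R ^+ 2 - 1)) = 0.
  have -> : (r + r') * (2 * 'i * (3 * n%:R ^+ 2 - 1)) =
     (r * (n%:R + 'i) ^+ 3 - r' * (n%:R - 'i) ^+ 3) -
     (r * (n%:R - 'i) ^+ 3 - r' * (n%:R + 'i) ^+ 3) by ring: i2.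
  by rewrite E Ec !subrr.
rewrite mulf_eq0 [X in _ || X](negPf _) ?orbF; last first.
  by rewrite !mulf_neq0 ?pnatr_eq0 ?neq0Ci ?three_natr_sqr_sub1_neq0.
move=> rr'; have nn (k : nat) : k.+1%:R != 0 :> C by rewrite pnatr_eq0.
move: sr tr rr'; rewrite !inE => /or3P[] /eqP -> /or3P[] /eqP -> /eqP rr' //; exfalso.
- by move/eqP: rr'; rewrite add0r (negPf (nn _)).
- by move/eqP: rr'; rewrite add0r oppr_eq0 (negPf (nn _)).
- by move/eqP: rr'; rewrite addr0 (negPf (nn _)).
- by move/eqP: rr'; rewrite -natrD (negPf (nn _)).
- by move/eqP: rr'; rewrite (_ : _ - _ = 12) ?(negPf (nn _))//; ring.
- by move/eqP: rr'; rewrite addr0 oppr_eq0 (negPf (nn _)).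
- by move/eqP: rr'; rewrite (_ : _ + _ = 12) ?(negPf (nn _))//; ring.
- by move/eqP: rr'; rewrite -opprD oppr_eq0 -natrD (negPf (nn _)).
Qed.

End FourthRoots.

(** * Absence of equations of z-degree below 16 *)

Section ZeroKernel.
Context {R : fieldType} {C : numClosedFieldType} (iota : {rmorphism R -> C}).
Implicit Types (g : mpoly 3 R) (m : multinom 3).

(** For a monomial [M] of maximal weight in the support, the leading form is shown to have
    coefficient 0 at [M]. The variables are removed one at a time: first z by counting 16 roots,
    then x by letting n vary, with y fixed at -1/4. *)
Lemma bour_no_small_equation g :
  (forall u v, meval (bour_coord u v) g = 0) ->
  (forall m, m \in msupp g -> (m 2%R < 16)%N) -> g = 0.
Proof.
move=> g0 z16; apply/eqP; rewrite -msupp_eq0; apply/negPn/negP => gn0.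
have i2 := sqrCi C.
have [M Mg maxM] : exists2 M, M \in msupp g &
    forall m, m \in msupp g -> (bour_weight m <= bour_weight M)%N.
  elim: (msupp g) gn0 => //= m [|m' s] IH _.
    by exists m => [|m']; rewrite ?inE// => /eqP ->.
  have [//|M Ms maxM] := IH.
  have [le|lt] := leqP (bour_weight m) (bour_weight M).
    by exists M => [|k]; rewrite inE ?Ms ?orbT// => /predU1P[->//|/maxM].
  exists m => [|k]; rewrite inE ?eqxx// => /predU1P[->//|/maxM le].
  exact: leq_trans le (ltnW lt).
set N := bour_weight M in maxM.
have lead := leading_form_vanish _ _ (bour_vanish_complex iota g0) maxM.
have form0 (n : nat) : \sum_(m <- msupp g | bour_weight m == N)
    (iota (mcoeff m g) * (- (n%:R / 4)) ^+ m 0 * (- (4^-1)) ^+ m 1) *: 'X^(m 2)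
    = 0 :> {poly C}.
  set Q := \sum_(m <- _ | _) _.
  (* With a^4 = n + i and b^4 = n - i, the first two arguments of the leading form become -n/4 and
     -1/4. *)
  pose a0 : C := sqrtC (sqrtC (n%:R + 'i)); pose b0 : C := sqrtC (sqrtC (n%:R - 'i)).
  have a4 : a0 ^+ 4 = n%:R + 'i by rewrite (exprM _ 2 2) !sqrtCK.
  have b4 : b0 ^+ 4 = n%:R - 'i by rewrite (exprM _ 2 2) !sqrtCK.
  have a34 : (a0 ^+ 3) ^+ 4 = (n%:R + 'i) ^+ 3 by rewrite exprAC a4.
  have b34 : (b0 ^+ 3) ^+ 4 = (n%:R - 'i) ^+ 3 by rewrite exprAC b4.
  pose rs := [seq (s * a0 ^+ 3 + t * b0 ^+ 3) / 3 |
               s <- @fourth_roots C, t <- @fourth_roots C].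
  apply: (@roots_geq_poly_eq0 _ _ rs).
  - apply/allP => _ /allpairsP[[s t] /= [sP tP ->]].
    (* The cubes s^3 and t^3 are used because (s^3)^3 = s for a fourth root of unity, so the third
       argument is the listed root. *)
    have := lead (s ^+ 3 * a0) (t ^+ 3 * b0).
    have cube (x y : C) : x ^+ 4 = 1 -> (x ^+ 3 * y) ^+ 3 = x * y ^+ 3.
      by move=> x4; rewrite exprMn -exprM (exprD _ 8 1) (exprM _ 4 2) x4 expr1n mul1r.
    have quart (x y : C) : x ^+ 4 = 1 -> (x ^+ 3 * y) ^+ 4 = y ^+ 4.
      by move=> x4; rewrite exprMn exprAC x4 expr1n mul1r.
    have s4 := fourth_rootsP sP; have t4 := fourth_rootsP tP.
    rewrite (cube _ _ s4) (cube _ _ t4) (quart _ _ s4) (quart _ _ t4) a4 b4.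
    have -> : - (n%:R + 'i + (n%:R - 'i)) / 8 = - (n%:R / 4) :> C by field.
    have -> : 'i * (n%:R + 'i - (n%:R - 'i)) / 8 = - (4^-1) :> C by field: i2.
    move=> lead0; apply/rootP; rewrite -[RHS]lead0 horner_sum.
    by apply: eq_bigr => m _; rewrite hornerZ hornerXn !mulrA.
  - apply: allpairs_uniq; rewrite ?fourth_roots_uniq//.
    move=> [s t] [s' t'] /allpairsP[[x y] E1] /allpairsP[[x' y'] E2].
    move: E1 E2 => /= [xP yP [-> ->]] [x'P y'P [-> ->]] /(mulIf _) E.
    have {}E : x * a0 ^+ 3 + y * b0 ^+ 3 = x' * a0 ^+ 3 + y' * b0 ^+ 3.
      by apply: E; rewrite invr_eq0 pnatr_eq0.
    by have [-> ->] := fourth_roots_comb_inj a34 b34 xP yP x'P y'P E.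
  - have -> : size rs = 16%N by rewrite size_allpairs.
    apply: (leq_trans (size_sum _ _ _)); apply/bigmax_leqP_seq => m mg _.
    by apply: leq_trans (size_scale_leq _ _) _; rewrite size_polyXn z16.
(* The value of [P] at n is the coefficient of Z^(M 2) in the polynomial of [form0 n]. *)
pose P := \sum_(m <- msupp g | (bour_weight m == N) && (m 2 == M 2))
  (iota (mcoeff m g) * (- (4^-1)) ^+ (m 0%R + m 1%R)%N) *: 'X^(m 0) : {poly C}.
have P0 : P = 0.
  apply: poly_eq0_nat => n; have := congr1 (fun p : {poly C} => p`_(M 2)) (form0 n.+1).
  rewrite coef0 coef_sum => form; rewrite -[RHS]form horner_sum big_mkcondr.
  apply: eq_bigr => m _; rewrite hornerZ hornerXn coefZ coefXn eq_sym.
  case: eqP => _; rewrite ?mulr0// mulr1 exprD.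
  rewrite (_ : - (n.+1%:R / 4) = - 4^-1 * n.+1%:R :> C) ?exprMn; last first.
    by rewrite mulNr mulrC.
  move: (n.+1%:R ^+ m 0) ((- 4^-1 : C) ^+ m 0) ((- 4^-1 : C) ^+ m 1) => x y z.
  by ring.
have := congr1 (fun p : {poly C} => p`_(M 0)) P0; rewrite coef0 coef_sum.
(* The weight and the exponents of x and z determine the exponent of y, so [M] alone contributes to
   this coefficient. *)
rewrite big_mkcond (bigD1_seq M) ?msupp_uniq//= !eqxx big1_seq; last first.
  move=> m /andP[mM mg]; case: ifP => // /andP[/eqP wm /eqP m2].
  rewrite coefZ coefXn; case: eqP => [m0|_]; rewrite ?mulr0//.
  case/eqP: mM; apply/mnmP; apply: ord3_ind; rewrite // -?m0//.
  by move: wm; rewrite /N /bour_weight m2 m0 => /addIn /addnI /eqP; rewrite eqn_pmul2l// => /eqP.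
rewrite addr0 coefZ coefXn eqxx mulr1 => /eqP.
rewrite mulf_eq0 expf_eq0 oppr_eq0 invr_eq0 pnatr_eq0 andbF orbF fmorph_eq0.
by move: Mg; rewrite mcoeff_msupp => /negPf ->.
Qed.

End ZeroKernel.

(** * The implicit equation *)

Section DegreeFiltration.
Context {n : nat} {K : fieldType} (phi : multinom n -> nat).
Hypothesis phiD : forall m1 m2, phi (mnm_add m1 m2) = (phi m1 + phi m2)%N.
Implicit Types (p q : mpoly n K) (k l : nat).

(** An arbitrary additive [phi] lets one estimate serve both the total degree and the z-degree. *)
Definition deg_le k p := forall m, m \in msupp p -> (phi m <= k)%N.

Lemma deg_leW k l p : (k <= l)%N -> deg_le k p -> deg_le l p.
Proof. by move=> kl pk m /pk /leq_trans; apply. Qed.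

Lemma deg_leD k p q : deg_le k p -> deg_le k q -> deg_le k (p + q).
Proof. by move=> pk qk m /msuppD_le; rewrite mem_cat => /orP[/pk|/qk]. Qed.

Lemma deg_leN k p : deg_le k p -> deg_le k (- p).
Proof. by move=> pk m; rewrite (perm_mem (msuppN _)) => /pk. Qed.

Lemma deg_leM k l p q : deg_le k p -> deg_le l q -> deg_le (k + l) (p * q).
Proof.
by move=> pk ql m /msuppM_le /allpairsP[[m1 m2] [/= /pk ? /ql ? ->]];
  rewrite phiD leq_add.
Qed.

Lemma deg_leZ k c p : deg_le k p -> deg_le k (c *: p).
Proof. by move=> pk m /msuppZ_le /pk. Qed.

Lemma deg_le_nat i : deg_le 0 i%:R.
Proof.
have phi0 : phi mnm0 = 0%N.
  by have := phiD mnm0 mnm0; rewrite add0m; lia.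
move=> m; rewrite -(rmorph_nat (@mpolyC n K)) msuppC.
by case: ifP => // _; rewrite inE => /eqP ->; rewrite phi0.
Qed.

Lemma deg_le_pow k i p : deg_le k p -> deg_le (k * i) (p ^+ i).
Proof.
move=> pk; elim: i => [|i IH]; first by rewrite muln0 expr0 -[1]mulr1n; exact: deg_le_nat.
by rewrite exprS mulnS; exact: deg_leM.
Qed.

End DegreeFiltration.

(* With w = u + iv, p = |w|^2 and q = p (p + 2), the polynomials D, P, B0, B1
   below satisfy D = q^2 and p P (1 + q) = B0 + q B1 on the surface.
   Eliminating p from p^2 + 2 p = q gives (B0^2 + U) + q V = 0, and then eliminating
   q gives (B0^2 + U)^2 - D V^2 = 0. *)
Section ImplicitPolynomial.
Context {A : comPzRingType}.
Implicit Types x y z : A.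

Definition bour_D x y z := 16 * (x ^+ 2 + y ^+ 2) + 18 * z ^+ 2.
Definition bour_P z := 36 * z ^+ 2.
Definition bour_T x y z := 128 * (x ^+ 3 - 3 * x * y ^+ 2) - 72 * z ^+ 2.
Definition bour_B0 x y z := 81 * z ^+ 4 + bour_T x y z.
Definition bour_B1 x y z := 2 * bour_D x y z + 18 * z ^+ 2.

Definition elim_U (D P B0 B1 : A) :=
  D * B1 ^+ 2 + 2 * P * (B0 + D * B1) - 2 * P ^+ 2 * D.
Definition elim_V (D P B0 B1 : A) :=
  2 * B0 * B1 + 2 * P * (B0 + B1) - P ^+ 2 * (1 + D).

Definition bour_implicit x y z :=
  let D := bour_D x y z in
  let P := bour_P z in
  let B0 := bour_B0 x y z in
  let B1 := bour_B1 x y z in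
  (B0 ^+ 2 + elim_U D P B0 B1) ^+ 2 - D * elim_V D P B0 B1 ^+ 2.

(** The left side is a difference of squares. Its factor (B0^2 + U) + q V is (p P (1 + q))^2 + 2 P
    (1 + q) (p P (1 + q)) - q P^2 (1 + q)^2, which is 0 because p^2 + 2 p = q. *)
Lemma elim_vanish (p P B1 : A) : let q := p * (p + 2) in
  let B0 := p * P * (1 + q) - q * B1 in
  (B0 ^+ 2 + elim_U (q ^+ 2) P B0 B1) ^+ 2 -
  q ^+ 2 * elim_V (q ^+ 2) P B0 B1 ^+ 2 = 0.
Proof.
move=> q B0; rewrite -exprMn subr_sqr.
by apply/eqP; rewrite mulrC (_ : _ + _ = 0) ?mul0r// /elim_U /elim_V /B0 /q; ring.
Qed.

(** Writing B0^2 + U = (81 z^4)^2 + W and expanding the square isolates (81 z^4)^4 = (3 z)^16; these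
    are the remaining terms. *)
Definition implicit_tail x y z :=
  let D := bour_D x y z in
  let P := bour_P z in
  let B0 := bour_B0 x y z in
  let B1 := bour_B1 x y z in
  let W := 2 * (81 * z ^+ 4) * bour_T x y z + bour_T x y z ^+ 2 + elim_U D P B0 B1 in
  2 * (81 * z ^+ 4) ^+ 2 * W + W ^+ 2 - D * elim_V D P B0 B1 ^+ 2.

Lemma bour_implicitE x y z :
  bour_implicit x y z = (3 * z) ^+ 16 + implicit_tail x y z.
Proof.
rewrite /bour_implicit /implicit_tail /=.
move: (elim_U _ _ _ _) (elim_V _ _ _ _) => U V; rewrite /bour_B0.
move: (bour_D _ _ _) (bour_T _ _ _) => D T.
by ring.
Qed.

End ImplicitPolynomial.

Lemma rmorph_bour_implicit (A B : comPzRingType) (f : {rmorphism A -> B}) x y z :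
  f (bour_implicit x y z) = bour_implicit (f x) (f y) (f z).
Proof.
rewrite /bour_implicit /elim_U /elim_V /bour_B0 /bour_B1 /bour_T /bour_P /bour_D.
by rewrite !(rmorphXn, rmorph_nat, rmorphN, rmorphD, rmorphM, rmorph1).
Qed.

Lemma bour_implicit_coord (K : numFieldType) (u v : K) :
  bour_implicit (bour_coord u v 0) (bour_coord u v 1) (bour_coord u v 2) = 0.
Proof.
rewrite -(elim_vanish (u ^+ 2 + v ^+ 2) (bour_P (bour_coord u v 2))
  (bour_B1 (bour_coord u v 0) (bour_coord u v 1) (bour_coord u v 2))).
rewrite /bour_implicit.
have -> : bour_D (bour_coord u v 0) (bour_coord u v 1) (bour_coord u v 2) =
    ((u ^+ 2 + v ^+ 2) * (u ^+ 2 + v ^+ 2 + 2)) ^+ 2.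
  by rewrite /bour_D /bour_coord /=; field.
have -> : bour_B0 (bour_coord u v 0) (bour_coord u v 1) (bour_coord u v 2) =
    (u ^+ 2 + v ^+ 2) * bour_P (bour_coord u v 2) *
      (1 + (u ^+ 2 + v ^+ 2) * (u ^+ 2 + v ^+ 2 + 2)) -
    (u ^+ 2 + v ^+ 2) * (u ^+ 2 + v ^+ 2 + 2) *
    bour_B1 (bour_coord u v 0) (bour_coord u v 1) (bour_coord u v 2).
  by rewrite /bour_B0 /bour_T /bour_B1 /bour_D /bour_P /bour_coord /=; field.
by [].
Qed.

(** * Degree of the implicit polynomial and division by it *)

Section BourIdeal.
Context {K : numFieldType}.
Implicit Types (g h p : mpoly 3 K) (m : multinom 3) (phi : multinom 3 -> nat).

Definition var (i : 'I_3) : mpoly 3 K := mpolyX K (mnm1 i).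

Definition bour_poly : mpoly 3 K := bour_implicit (var 0) (var 1) (var 2).

(** The degrees are at most 2 for D, P and B1, 3 for T, 4 for B0, 6 for U and V, and 7 for W. The
    three summands of the tail are then bounded by 8 + 7, 14 and 2 + 12. *)
Lemma deg_le_tail phi :
  (forall m1 m2, phi (mnm_add m1 m2) = (phi m1 + phi m2)%N) ->
  (forall i, (phi (mnm1 i) <= 1)%N) ->
  deg_le phi 15 (implicit_tail (var 0) (var 1) (var 2)).
Proof.
move=> phiD phi1.
have dV i : deg_le phi 1 (var i) by move=> m; rewrite msuppX inE => /eqP ->.
have dM k l d p q : (k + l <= d)%N -> deg_le phi k p -> deg_le phi l q ->
    deg_le phi d (p * q).
  by move=> kl pk ql; apply: deg_leW kl _; exact: deg_leM.
have dX k i d p : (k * i <= d)%N -> deg_le phi k p -> deg_le phi d (p ^+ i).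
  by move=> kl pk; apply: deg_leW kl _; exact: deg_le_pow.
have dn k (i : nat) p : deg_le phi k p -> deg_le phi k (i%:R * p).
  by move=> pk; apply: (dM 0%N k) => //; exact: deg_le_nat.
have dz i : deg_le phi i (var 2 ^+ i) by apply: (dX 1%N) => //; rewrite mul1n.
rewrite /implicit_tail /=.
set D := bour_D _ _ _; set P := bour_P _; set T := bour_T _ _ _.
set B0 := bour_B0 _ _ _; set B1 := bour_B1 _ _ _.
have dD : deg_le phi 2 D.
  apply: deg_leD; apply: (dn _ _ _) => //.
  by apply: deg_leD; apply: (dX 1%N).
have dP : deg_le phi 2 P by exact: dn.
have dT : deg_le phi 3 T.
  apply: deg_leD; last by apply/deg_leN/dn; exact: deg_leW (dz 2%N).
  apply: (dn _ _ _); apply: deg_leD; first exact: (dX 1%N).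
  by apply: deg_leN; apply: (dM 1%N 2%N) => //; [by apply: (dn _ _ _) | by apply: (dX 1%N)].
have dB0 : deg_le phi 4 B0.
  by apply: deg_leD; [exact: dn | exact: deg_leW dT].
have dB1 : deg_le phi 2 B1 by apply: deg_leD; exact: dn.
move: D P T B0 B1 dD dP dT dB0 dB1 => D P T B0 B1 dD dP dT dB0 dB1.
have d81 : deg_le phi 4 (81 * var 2 ^+ 4) by exact: dn.
have dU : deg_le phi 6 (elim_U D P B0 B1).
  apply: deg_leD; [apply: deg_leD|apply: deg_leN].
  - by apply: (dM 2%N 4%N) => //; exact: (dX 2%N).
  - apply: (dM 2%N 4%N) => //; first exact: dn.
    by apply: deg_leD => //; exact: (dM 2%N 2%N).
  - by apply: (dM 4%N 2%N) => //; apply: (dn _ _ _); exact: (dX 2%N).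
have dV6 : deg_le phi 6 (elim_V D P B0 B1).
  apply: deg_leD; [apply: deg_leD|apply: deg_leN].
  - by apply: (dM 4%N 2%N) => //; exact: dn.
  - apply: (dM 2%N 4%N) => //; first exact: dn.
    by apply: deg_leD => //; exact: deg_leW dB1.
  - apply: (dM 4%N 2%N) => //; first exact: (dX 2%N).
    by apply: deg_leD => //; apply: (@deg_leW _ _ _ 0); rewrite // -[1]mulr1n; exact: deg_le_nat.
set W := (X in _ * X + X ^+ 2).
have dW : deg_le phi 7 W.
  apply: deg_leD; last exact: deg_leW dU.
  by apply: deg_leD; [apply: (dM 4%N 3%N) => //; exact: dn | apply: (dX 3%N)].
apply: deg_leD; [apply: deg_leD|apply: deg_leN].
- by apply: (dM 8%N 7%N) => //; apply: (dn _ _ _); exact: (dX 4%N).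
- exact: (dX 7%N).
- by apply: (dM 2%N 12%N) => //; exact: (dX 6%N).
Qed.

Lemma bour_polyE :
  bour_poly = (3 * var 2) ^+ 16 + implicit_tail (var 0) (var 1) (var 2).
Proof. exact: bour_implicitE. Qed.

Lemma bour_poly_coord (u v : K) : meval (bour_coord u v) bour_poly = 0.
Proof.
by rewrite [LHS](rmorph_bour_implicit (meval (bour_coord u v))) /= !mevalXU
  bour_implicit_coord.
Qed.

Let three16_neq0 : (3 : K) ^+ 16 != 0.
Proof. by rewrite expf_neq0// pnatr_eq0. Qed.

Lemma lead_termE : (3 * var 2) ^+ 16 =
  (3 : K) ^+ 16 *: mpolyX K (mnm_muln (mnm1 2) 16) :> mpoly 3 K.
Proof. by rewrite exprMn mpolyXn -mul_mpolyC rmorphXn rmorph_nat. Qed.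

Lemma msize_bour_poly : msize bour_poly = 17%N.
Proof.
have tail : deg_le mdeg 15 (implicit_tail (var 0) (var 1) (var 2)).
  by apply: deg_le_tail => [|i]; [exact: mdegD | rewrite mdeg1].
have m16 : mnm_muln (mnm1 2) 16 \in msupp ((3 * var 2) ^+ 16 : mpoly 3 K).
  by rewrite lead_termE (perm_mem (msuppZ _ three16_neq0)) msuppX inE.
have deg16 : mdeg (mnm_muln (mnm1 (2 : 'I_3)) 16) = 16%N by rewrite mdegMn mdeg1.
apply/eqP; rewrite eqn_leq; apply/andP; split.
  rewrite msizeE; apply/bigmax_leqP_seq => m + _; rewrite ltnS => mf.
  move: m mf; rewrite bour_polyE; apply: deg_leD; last exact: deg_leW tail.
  rewrite lead_termE; apply: deg_leZ => m.
  by rewrite msuppX inE => /eqP ->; rewrite deg16.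
(* Otherwise (3 z)^16, the difference of the polynomial and its tail, would have degree at most
   15. *)
rewrite leqNgt; apply/negP => lt17.
have : deg_le mdeg 15 ((3 * var 2) ^+ 16 : mpoly 3 K).
  have -> : (3 * var 2) ^+ 16 = bour_poly - implicit_tail (var 0) (var 1) (var 2).
    by rewrite bour_polyE addrK.
  apply: deg_leD; last exact: deg_leN.
  by move=> m /msize_mdeg_lt mf; rewrite -ltnS; exact: leq_trans mf _.
by move=> /(_ _ m16); rewrite deg16.
Qed.

Definition zdeg m : nat := m 2.

Lemma zdegD m1 m2 : zdeg (mnm_add m1 m2) = (zdeg m1 + zdeg m2)%N.
Proof. exact: mnmDE. Qed.

Lemma zdeg1 i : (zdeg (mnm1 i) <= 1)%N.
Proof. by rewrite /zdeg mnm1E leq_b1. Qed.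

(** Euclidean division in z works over the other variables because the leading coefficient 3^16 is
    an invertible constant. *)
Lemma bour_division k g : deg_le zdeg k g ->
  exists h r, g = h * bour_poly + r /\ deg_le zdeg 15 r.
Proof.
elim: k g => [|k IH] g gk.
  by exists 0, g; split; [rewrite mul0r add0r | exact: deg_leW gk].
have [k15|k15] := leqP k.+1 15.
  by exists 0, g; split; [rewrite mul0r add0r | exact: deg_leW gk].
pose e : multinom 3 := mnm_muln (mnm1 2) 16.
pose h0 := \sum_(m <- msupp g | zdeg m == k.+1) mcoeff m g *: mpolyX K (mnm_sub m e).
pose g0 := \sum_(m <- msupp g | zdeg m != k.+1) mcoeff m g *: mpolyX K m.
have e2 i : e i = (16 * (2%R == i))%N by rewrite mulmnE mnm1E mulnC.
have gE : g = h0 * mpolyX K e + g0.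
  rewrite {1}[g]mpolyE (bigID (fun m : multinom 3 => zdeg m == k.+1)) /=.
  congr (_ + _); rewrite /h0 big_distrl; apply: eq_bigr => m /eqP mk /=.
  rewrite -scalerAl -mpolyXD submK//; apply/mnm_lepP => i; rewrite e2.
  by case: eqP => [<-|_]; rewrite ?muln0// muln1 -/(zdeg m) mk.
have sum_deg (P : pred (multinom 3)) (F : multinom 3 -> multinom 3) d :
    (forall m, m \in msupp g -> P m -> zdeg (F m) <= d)%N ->
    deg_le zdeg d (\sum_(m <- msupp g | P m) mcoeff m g *: mpolyX K (F m)).
  move=> Fd; rewrite big_seq_cond; apply: big_ind.
  - by move=> m; rewrite msupp0.
  - exact: deg_leD.
  - move=> m /andP[mg Pm]; apply: deg_leZ => m'.
    by rewrite msuppX inE => /eqP ->; exact: Fd.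
have h0k : deg_le zdeg (k.+1 - 16)%N h0.
  by apply: sum_deg => m _ /eqP mk; rewrite /zdeg mnmBE e2 -/(zdeg m) mk.
have g0k : deg_le zdeg k g0.
  by apply: sum_deg => m mg mk; rewrite -ltnS ltn_neqAle mk gk.
(* Modulo [bour_poly], z^16 is -3^(-16) times the tail. Substituting this into [h0] z^16 lowers the
   z-degree, since (k + 1 - 16) + 15 = k. *)
have [|h [r [E rk]]] := IH (g0 - (3 ^- 16) *: (h0 * implicit_tail (var 0) (var 1) (var 2))).
  apply: deg_leD => //; apply/deg_leN/deg_leZ.
  apply: (@deg_leW _ _ _ (k.+1 - 16 + 15)%N); first by lia.
  by apply: (deg_leM zdegD) => //; exact: (deg_le_tail zdegD zdeg1).
exists (h + 3 ^- 16 *: h0), r; split=> //.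
have -> : (h + 3 ^- 16 *: h0) * bour_poly + r =
    (h * bour_poly + r) + (3 ^- 16 *: h0) * bour_poly by ring.
rewrite -E bour_polyE lead_termE -!mul_mpolyC {1}gE.
have cc : mpolyC 3 (3 ^- 16 : K) * mpolyC 3 (3 ^+ 16) = 1.
  by rewrite -mpolyCM mulVf.
by rewrite -[h0 * mpolyX _ _]mul1r -cc; ring.
Qed.

Lemma irreducible_mul_unit g h : irreducible g -> irreducible (h * g) ->
  exists2 c : K, c != 0 & h * g = c *: g.
Proof.
move=> [_ gU _] [_ _ /(_ h g erefl)] [|/(negP gU)[]].
(* A unit of the polynomial ring is an invertible constant, read off as the constant coefficient. *)
move=> /andP[/eqP hE hU]; exists (mcoeff mnm0 h); first by rewrite -unitfE.
by rewrite {1}hE mul_mpolyC.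
Qed.

End BourIdeal.

(** * The prime ideal of the surface *)

Section BourKernel.
Context {K : numFieldType} {C : numClosedFieldType} (iota : {rmorphism K -> C}).
Implicit Types (g h : mpoly 3 K).

Definition bour_vanish g := forall u v : K, meval (bour_coord u v) g = 0.

(** The remainder of the division vanishes on the surface and has z-degree at most 15, hence is
    0. *)
Lemma bour_vanishP g : bour_vanish g <-> exists h, g = h * bour_poly.
Proof.
split=> [g0|[h ->] u v]; last by rewrite rmorphM /= bour_poly_coord mulr0.
have [|h [r [gE r15]]] := @bour_division _ (\max_(m <- msupp g) zdeg m) g.
  by move=> m mg; exact: (@leq_bigmax_seq _ _ _ zdeg).
exists h; rewrite gE (bour_no_small_equation iota (g := r)) ?addr0// => u v.
have := g0 u v; rewrite gE rmorphD rmorphM /= bour_poly_coord.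
by rewrite mulr0 add0r.
Qed.

(** Join a parameter where [g] is nonzero to one where [h] is nonzero by a line. Along it both
    become polynomials in t with zero product, so one of them is 0, which contradicts its value at t
    = 0 or at t = 1. *)
Lemma bour_vanishM g h : bour_vanish (g * h) -> bour_vanish g \/ bour_vanish h.
Proof.
move=> gh0; apply/or_asboolP; rewrite -[_ || _]negbK negb_or; apply/negP.
move=> /andP[/asboolPn/existsNP[u0 /existsNP[v0 g0]]].
move=> /asboolPn/existsNP[u1 /existsNP[v1 h1]].
pose line t := bour_coord (u0 + t * (u1 - u0)) (v0 + t * (v1 - v0)).
have pline i : polyfun (fun t => line t i).
  elim/ord3_ind: i; rewrite /line /bour_coord /=; solve_polyfun.
have [p pE] := polyfun_mmap idfun g pline.
have [q qE] := polyfun_mmap idfun h pline.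
have /eqP : p * q = 0.
  apply: poly_eq0_nat => n; rewrite hornerM -pE -qE.
  by have := gh0 (u0 + n.+1%:R * (u1 - u0)) (v0 + n.+1%:R * (v1 - v0)); rewrite rmorphM.
rewrite mulf_eq0 => /orP[] /eqP e0.
- by apply: g0; have := pE 0; rewrite e0 horner0 /line !mul0r !addr0.
- by apply: h1; have := qE 1; rewrite e0 horner0 /line !mul1r !subrKC.
Qed.

Lemma bour_poly_irreducible : irreducible (@bour_poly K).
Proof.
have f0 : @bour_poly K != 0 by rewrite -msize_poly_eq0 msize_bour_poly.
have fV : bour_vanish bour_poly by move=> u v; exact: bour_poly_coord.
(* A vanishing factor is a multiple k f of f = [bour_poly], and f = k f h gives h k = 1 by
   cancellation. *)
have cofactor g h : bour_poly = g * h -> bour_vanish g -> h \is a GRing.unit.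
  move=> fE /bour_vanishP[k gE]; apply/unitrPr; exists k.
  by apply: (mulfI f0); rewrite mulr1 {2}fE gE; ring.
split=> // [|g h fE].
- apply/negP => /unitrPr[k /(congr1 (meval (bour_coord 0 0)))].
  by rewrite rmorphM rmorph1 /= fV mul0r => /esym/eqP; rewrite oner_eq0.
- have : bour_vanish (g * h) by rewrite -fE.
  case/bour_vanishM => [/(cofactor _ _ fE)|hV]; first by right.
  by left; apply: (cofactor h g) => //; rewrite mulrC.
Qed.

End BourKernel.

Theorem mainTheorem1 (R : realType) :
  [/\ algebraic_surface (@Bour3 R),
      minimal_surface (@Bour3 R)
    & surface_degree (@Bour3 R) 16].
Proof.
have coordE (g : mpoly 3 R) : vanishes_on g Bour3 <-> bour_vanish g.
  have E (u v : R) : Bour3 (u, v) 0 =1 bour_coord u v by move=> i; rewrite mxE.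
  split=> [g0 u v|g0 [u v]]; first by rewrite -(meval_eq _ (E u v)); exact: g0.
  by rewrite (meval_eq _ (E u v)); exact: g0.
have fV : vanishes_on bour_poly (@Bour3 R).
  by apply/coordE => u v; exact: bour_poly_coord.
(* The algebraically closed field of the kernel computation is R[i]. *)
have irr := bour_poly_irreducible (real_complex R).
split.
- by exists bour_poly; split=> //; case: irr.
- exact: minimal_surface_Bour3.
- exists bour_poly; split; last exact: msize_bour_poly.
  split=> // g + /coordE/(bour_vanishP (real_complex R))[h gE].
  by rewrite gE; exact: irreducible_mul_unit.
Qed.
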